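(* Let $s,t$ be integers and $p$ a prime such that $s=p^as'$ and $t=p^bt'$, where $s',t'$ are integers with $p\nmid s't'$, $b$ is a positive integer, $a$ is a positive integer or $a=\infty$ (where $a=\infty$ means $s=0$), and $b<2a$. Let $(P_n)_{n\ge 1}$ be the sequence of Lucas atoms associated with $(s,t)$. If $p\notin\{2,3\}$ or $b<2a-1$, then for each $n\ge 2$, \[ v_p(P_n)=\begin{cases} a & \text{if } n=2,\\ b\,\dfrac{\varphi(n)}{2}+1 & \text{if } n=2p^h \text{ for some integer } h\ge 1,\\ b\,\dfrac{\varphi(n)}{2} & \text{otherwise.}\end{cases} \]
   Context: Lucas atoms: for $n\ge 1$ let $\Phi_n(\alpha,\beta)=\prod_{1\le j\le n,\ \gcd(j,n)=1}(\alpha-\omega^j\beta)$, with $\omega$ a primitive $n$-th root of unity (the homogenization of the $n$-th cyclotomic polynomial). Put $P_1(s,t)=1$, and for $n\ge 2$ let $P_n(s,t)\in\mathbb Z[s,t]$ be the unique polynomial with $P_n(\alpha+\beta,-\alpha\beta)=\Phi_n(\alpha,\beta)$ as polynomials in the variables $\alpha,\beta$. For integers $s,t$, $P_n$ denotes the integer value $P_n(s,t)$. $v_p$ is the $p$-adic valuation, with $v_p(0)=+\infty$; $\varphi$ is Euler's totient function. *)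

(* Defs.v *)
From HB Require Import structures.
From mathcomp Require Import all_boot all_order all_fingroup all_algebra all_field.
From mathcomp Require Import mpoly.

Set Implicit Arguments.
Unset Strict Implicit.
Unset Printing Implicit Defensive.

Import Order.TTheory GRing.Theory Num.Theory.
Local Open Scope ring_scope.

(* In {mpoly R[2]} the variables 'X_ord0 and 'X_ord_max stand for alpha and   *)
(* beta (or for s and t, as arguments of a Lucas atom).                       *)

Definition Phi (n : nat) (w : algC) : {mpoly algC[2]} :=
  \prod_(1 <= j < n.+1 | coprime j n) ('X_ord0 - w ^+ j *: 'X_ord_max).

Definition lucas_subst : 2.-tuple {mpoly int[2]} :=
  [tuple 'X_ord0 + 'X_ord_max; - ('X_ord0 * 'X_ord_max)].

Definition is_lucas_atom (n : nat) (P : {mpoly int[2]}) : Prop :=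
  forall w : algC, n.-primitive_root w ->
    map_mpoly intr (P \mPo lucas_subst) = Phi n w.

Section Homogenize.
Variable R : comNzRingType.
Implicit Types (p : {poly R}) (c : R).

Definition homogenize (d : nat) p : {mpoly R[2]} :=
  \sum_(i < d.+1) p`_i *: ('X_ord0 ^+ i * 'X_ord_max ^+ (d - i)).

Lemma homogenizeM d p c : (size p <= d.+1)%N ->
  homogenize d.+1 (('X - c%:P) * p)
    = ('X_ord0 - c *: 'X_ord_max) * homogenize d p.
Proof.
move=> sp; rewrite /homogenize.
have -> : \sum_(i < d.+2) (('X - c%:P) * p)`_i *:
            ('X_ord0 ^+ i * 'X_ord_max ^+ (d.+1 - i)) =
  \sum_(i < d.+2) ('X * p)`_i *: ('X_ord0 ^+ i * 'X_ord_max ^+ (d.+1 - i)) -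
  \sum_(i < d.+2) (c%:P * p)`_i *: ('X_ord0 ^+ i * 'X_ord_max ^+ (d.+1 - i))
     :> {mpoly R[2]}.
  by rewrite -sumrB; apply: eq_bigr => i _; rewrite mulrBl coefB scalerBl.
rewrite mulrBl; congr (_ - _).
  rewrite big_ord_recl /= coefXM /= scale0r add0r mulr_sumr.
  apply: eq_bigr => i _; rewrite coefXM /= /bump /= add1n /= subSS.
  by rewrite exprS -mulrA -scalerAr.
rewrite big_ord_recr /= coefCM (nth_default _ sp) mulr0 scale0r addr0 mulr_sumr.
apply: eq_bigr => i _; rewrite coefCM -scalerAl -scalerAr scalerA.
have le_id : (i <= d)%N by rewrite -ltnS.
by rewrite (subSn le_id) (exprS _ (d - i)) mulrCA.
Qed.

Lemma homogenize_prod (cs : seq R) :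
  homogenize (size cs) (\prod_(c <- cs) ('X - c%:P))
    = \prod_(c <- cs) ('X_ord0 - c *: 'X_ord_max).
Proof.
elim: cs => [|c cs IH] /=.
  by rewrite /homogenize big_ord1 !big_nil coef1 /= scale1r !expr0 mulr1.
by rewrite !big_cons homogenizeM ?IH // size_prod_XsubC.
Qed.

End Homogenize.

Lemma ord2P (i : 'I_2) : i = ord0 \/ i = ord_max.
Proof. by case: i => [[|[|//]]] ?; [left | right]; apply/val_inj. Qed.

Lemma PhiE n w : (1 < n)%N ->
  Phi n w = \prod_(1 <= j < n | coprime j n) ('X_ord0 - w ^+ j *: 'X_ord_max).
Proof.
move=> n1; rewrite /Phi big_mkcond big_nat_recr /=; last exact: ltnW.
by rewrite /coprime gcdnn gtn_eqF // mulr1 -big_mkcond.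
Qed.

Lemma Phi_int n w : (1 < n)%N -> n.-primitive_root w ->
  map_mpoly intr (homogenize (totient n) 'Phi_n) = Phi n w.
Proof.
move=> n1 prim_w; rewrite PhiE //.
pose cs := [seq w ^+ j | j <- [seq j <- index_iota 1 n | coprime j n]].
have cycE : cyclotomic w n = \prod_(c <- cs) ('X - c%:P).
  rewrite /cyclotomic big_map big_filter.
  rewrite -(big_mkord (fun k => coprime k n) (fun k => 'X - (w ^+ k)%:P)).
  rewrite big_mkcond big_ltn ?(ltnW n1) //.
  by rewrite /coprime gcd0n gtn_eqF //= mul1r -big_mkcond.
have scs : size cs = totient n.
  have := size_cyclotomic w n; rewrite cycE size_prod_XsubC => -[].
  by [].
transitivity (\prod_(c <- cs) ('X_ord0 - c *: 'X_ord_max) : {mpoly algC[2]}).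
  rewrite -homogenize_prod scs -cycE -(Cintr_Cyclotomic prim_w).
  rewrite /homogenize raddf_sum; apply: eq_bigr => i _ /=.
  by rewrite map_mpolyZ coef_map rmorphM !rmorphXn /= !map_mpolyX.
by rewrite big_map big_filter.
Qed.

Lemma Phi_swap n w : (1 < n)%N -> n.-primitive_root w ->
  \prod_(1 <= j < n | coprime j n) ('X_ord_max - w ^+ j *: 'X_ord0) = Phi n w.
Proof.
move=> n1 prim_w.
pose c := \prod_(1 <= j < n | coprime j n) (- w ^+ j).
have cE : \prod_(1 <= j < n | coprime j n) ('X_ord_max - w ^+ j *: 'X_ord0)
          = c *: Phi n w.
  rewrite PhiE // [in RHS]big_nat_rev /= -mul_mpolyC rmorph_prod /=.
  have -> : \prod_(1 <= i < n | coprime (1 + n - i.+1) n)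
     ('X_ord0 - w ^+ (1 + n - i.+1) *: 'X_ord_max) =
    \prod_(1 <= i < n | coprime i n) ('X_ord0 - w ^+ (n - i) *: 'X_ord_max)
     :> {mpoly algC[2]}.
    rewrite [LHS]big_nat_cond [RHS]big_nat_cond.
    apply: eq_big => [i|i _]; last by rewrite add1n subSS.
    rewrite add1n subSS; case lt_in: (1 <= i < n)%N => //=.
    have /andP[_ /ltnW le_in] := lt_in.
    have -> : coprime i n = coprime i (n - i).
      by rewrite /coprime -{1}(subnK le_in) gcdnDr.
    by rewrite coprime_sym /coprime -{1}(subnK le_in) gcdnC gcdnDl gcdnC.
  rewrite -big_split /= [LHS]big_nat_cond [RHS]big_nat_cond.
  apply: eq_bigr => i /andP[/andP[_ lt_in] _].
  rewrite mul_mpolyC scalerBr scalerA !mulNr -exprD subnKC; last exact: ltnW.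
  by rewrite (prim_expr_order prim_w) !scaleNr scale1r opprK addrC.
suff c1 : c = 1 by rewrite cE c1 scale1r.
pose N := (Phi n w).@[fun _ => 1].
have N0 : N != 0.
  rewrite /N PhiE // rmorph_prod prodf_seq_neq0; apply/allP => j.
  rewrite mem_index_iota => /andP[j0 jn]; apply/implyP => _ /=.
  rewrite mevalB mevalZ !mevalXU mulr1 subr_eq0 eq_sym -(prim_order_dvd prim_w).
  by rewrite gtnNdvd.
apply: (mulIf N0); rewrite mul1r -mevalZ -cE /N PhiE // !rmorph_prod /=.
by apply: eq_bigr => j _; rewrite !mevalB !mevalZ !mevalXU.
Qed.

Lemma map_mpoly_intr_inj :
  injective (map_mpoly intr : {mpoly int[2]} -> {mpoly algC[2]}).
Proof.
move=> P Q /mpolyP eqPQ; apply/mpolyP => m.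
by have := eqPQ m; rewrite !mcoeff_map_mpoly => /intr_inj.
Qed.

Lemma homogenize_Cyclotomic_sym n : (1 < n)%N ->
  homogenize (totient n) 'Phi_n \is symmetric.
Proof.
move=> n1; have [w prim_w] := C_prim_root_exists (ltnW n1).
have msym_X (R : nzRingType) (s : 'S_2) i : msym s ('X_i : {mpoly R[2]}) = 'X_(s i).
  by rewrite /msym mmapX mmap1U.
have map_msym (s : 'S_2) (P : {mpoly int[2]}) :
    map_mpoly intr (msym s P) = msym s (map_mpoly intr P) :> {mpoly algC[2]}.
  by apply/mpolyP => m; rewrite mcoeff_map_mpoly !mcoeff_sym mcoeff_map_mpoly.
apply/issymP => s; apply: map_mpoly_intr_inj; rewrite map_msym (Phi_int n1 prim_w).
have sD : s ord0 != s ord_max by rewrite (inj_eq perm_inj).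
rewrite {1}PhiE // rmorph_prod /=.
under eq_bigr do rewrite msymB msymZ !msym_X.
case: (ord2P (s ord0)) (ord2P (s ord_max)) sD => -> [] -> // _.
  by rewrite -PhiE.
exact: Phi_swap.
Qed.

Lemma comp_mpolyA (P : {mpoly int[2]}) (a b : 2.-tuple {mpoly int[2]}) :
  (P \mPo a) \mPo b = P \mPo [tuple tnth a i \mPo b | i < 2].
Proof.
rewrite (comp_mpolyEX P a) (comp_mpolyEX P) raddf_sum; apply: eq_bigr => m _ /=.
rewrite comp_mpolyZ !comp_mpolyX rmorph_prod; congr (_ *: _).
by apply: eq_bigr => i _ /=; rewrite rmorphXn /= tnth_mktuple.
Qed.

Definition negate_snd : 2.-tuple {mpoly int[2]} :=
  [tuple 'X_ord0; - 'X_ord_max].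

Lemma negate_sndK (P : {mpoly int[2]}) :
  (P \mPo negate_snd) \mPo negate_snd = P.
Proof.
rewrite comp_mpolyA -[RHS]comp_mpoly_id; congr (_ \mPo _).
apply: eq_from_tnth => i; rewrite !tnth_mktuple.
by case: (ord2P i) => ->; rewrite !(tnth_nth 0) /= ?comp_mpolyN comp_mpolyXU ?opprK.
Qed.

Lemma comp_lucas_subst (P : {mpoly int[2]}) :
  P \mPo lucas_subst = (P \mPo negate_snd) \mPo [tuple @mesym 2 int i.+1 | i < 2].
Proof.
rewrite comp_mpolyA; congr (_ \mPo _); apply: eq_from_tnth => i.
rewrite tnth_mktuple; case: (ord2P i) => ->.
  rewrite !(tnth_nth 0) /= comp_mpolyXU -tnth_nth tnth_mktuple mesym1E.
  by rewrite big_ord_recl big_ord1; congr (_ + 'X_ _); apply: val_inj.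
rewrite !(tnth_nth 0) /= comp_mpolyN comp_mpolyXU -tnth_nth tnth_mktuple mesymnnE.
by rewrite big_ord_recl big_ord1; congr (- (_ * 'X_ _)); apply: val_inj.
Qed.

Lemma lucas_atom_exists n : (1 < n)%N -> {P | is_lucas_atom n P}.
Proof.
move=> n1; have [t [tE _]] := sym_fundamental (homogenize_Cyclotomic_sym n1).
exists (t \mPo negate_snd) => w prim_w.
by rewrite comp_lucas_subst negate_sndK tE (Phi_int n1 prim_w).
Qed.

Lemma lucas_atom_unique n (P Q : {mpoly int[2]}) : (0 < n)%N ->
  is_lucas_atom n P -> is_lucas_atom n Q -> P = Q.
Proof.
move=> n0 atomP atomQ; have [w prim_w] := C_prim_root_exists n0.
have := atomP w prim_w; rewrite -(atomQ w prim_w) => /map_mpoly_intr_inj.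
rewrite !comp_lucas_subst => /msym_fundamental_un eqPQ.
by rewrite -[P]negate_sndK eqPQ negate_sndK.
Qed.

(* The atoms are indexed by n >= 1; the value at 0 is junk. *)
Definition lucas_atom (n : nat) : {mpoly int[2]} :=
  if @idP (1 < n)%N is ReflectT n1 then sval (lucas_atom_exists n1) else 1.

Lemma lucas_atom1 : lucas_atom 1 = 1.
Proof. by rewrite /lucas_atom; case: {-}_ / idP. Qed.

Lemma lucas_atomP n : (1 < n)%N -> is_lucas_atom n (lucas_atom n).
Proof.
by rewrite /lucas_atom; case: {-}_ / idP => // n1 _; exact: svalP.
Qed.

Definition lucas_atom_value (s t : int) (n : nat) : int :=
  (lucas_atom n).@[tnth [tuple s; t]].

(* None is +oo. *)
Definition natbar := option nat.

Definition vp (p : nat) (x : int) : natbar :=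
  if x == 0 then None else Some (logn p `|x|%N).

(* p ^ a * x, where p ^ +oo is read as 0. *)
Definition ppow_mul (p : nat) (a : natbar) (x : int) : int :=
  if a is Some k then p%:Z ^+ k * x else 0.

Definition lt_bar (m : nat) (a : natbar) : bool :=
  if a is Some k then (m < k)%N else true.

(* Main.v *)
(* Let x, y be the roots of z^2 - s z - t and w a primitive n-th root of      *)
(* unity. Multiplying the factors x - w^j y and y - w^j x gives               *)
(*   P_n^2 = (-1)^phi(n) prod_j (t (1 + w^j)^2 + w^j s^2),                    *)
(* and since b < 2a we may write s^2 = p^(b+1) r, so that, phi(n) being even, *)
(*   P_n^2 = p^(b phi(n)) prod_j (t' (1 + w^j)^2 + w^j p r).                  *)
(* The last product is a rational integer. Modulo p it is t'^phi(n) times the *)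
(* square of prod_j (1 + w^j) = Phi_n(-1). For n > 2, evaluating              *)
(*   prod_(d | k m, d does not divide k) Phi_d = sum_(i < m) X^(k i)          *)
(* at -1 shows that Phi_n(-1) is prime to p unless n = 2 p^h. In that case    *)
(* Phi_n(-1) = +-p and all the 1 + w^j are associated                         *)
(* algebraic integers u with u^phi(n) ~ p; as phi(n) >= 4 or p | r, the       *)
(* number p r is a multiple of u^4, so that u^2 can be factored out of each   *)
(* term, leaving a product congruent to t'^phi(n) modulo u.                   *)

Require Import Defs.
From mathcomp Require Import all_boot all_order all_algebra all_field.
From mathcomp Require Import mpoly.
From mathcomp Require Import zify ring.

Import Order.TTheory GRing.Theory Num.Theory.

(** Pairing each factor of [P_n] with the one where the roots are exchanged writes [P_n^2] as a
    product involving only [s], [t] and [w] ([sqr_lucas_atom_value]). Since [b < 2a], every factor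
    is divisible by [p^b], so [P_n^2 = p^(b phi(n)) z] with an integer [z]
    ([sqr_lucas_atom_value_reduced]). Everything then depends on [f = Phi_n(-1)], up to sign the
    product of the [1 + w^j], because [z] is [t'^phi(n) f^2] modulo [p]. If [p] does not divide [f]
    ([Cyclotomic_N1_ndvd]), neither does it divide [z] ([vp_lucas_atom_generic]). If [n = 2 p^h],
    then [f = +-p] ([Cyclotomic_N1_2pfactor]) and that congruence is too weak; working modulo
    [1 + w], whose [phi(n)]-th power is an associate of [p], shows that [z] is [p^2] times an
    integer prime to [p] ([vp_lucas_atom_exceptional]). *)

Section CyclotomicAtMinusOne.

(** * Values of cyclotomic polynomials at -1 *)

Local Open Scope ring_scope.

(** Both sides are the quotient of [X^(k m) - 1] by [X^k - 1]. *)
Lemma prod_Cyclotomic_ndvd (k m : nat) : (0 < k)%N -> (0 < m)%N ->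
  \prod_(d <- divisors (k * m) | ~~ (d %| k)%N) 'Phi_d
    = \sum_(i < m) 'X^(k * i) :> {poly int}.
Proof.
move=> k0 m0; have km0 : (0 < k * m)%N by rewrite muln_gt0 k0.
have nz : 'X^k - 1 != 0 :> {poly int} by rewrite monic_neq0 ?monicXnsubC.
apply: (mulfI nz).
have -> : ('X^k - 1) * \sum_(i < m) 'X^(k * i) = 'X^(k * m) - 1 :> {poly int}.
  rewrite exprM -[X in _ = _ - X](expr1n _ m) subrXX; congr (_ * _).
  rewrite (reindex_inj rev_ord_inj); apply: eq_bigr => i _ /=.
  by rewrite expr1n mulr1 exprM subnS predn_sub.
rewrite -(prod_Cyclotomic km0) [RHS](bigID (dvdn^~ k)) /=; congr (_ * _).
rewrite -prod_Cyclotomic // -[RHS]big_filter; apply: perm_big.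
apply: uniq_perm; rewrite ?filter_uniq ?divisors_uniq // => d.
rewrite mem_filter -!dvdn_divisors //.
by case dk: (d %| k)%N => //=; rewrite dvdn_mulr.
Qed.

Lemma Cyclotomic_dvd_sum_Xn (k m : nat) : (0 < k)%N -> (1 < m)%N ->
  exists q : {poly int}, \sum_(i < m) 'X^(k * i) = 'Phi_(k * m) * q.
Proof.
move=> k0 m1; have m0 := ltnW m1; rewrite -prod_Cyclotomic_ndvd //.
rewrite -big_filter (bigD1_seq (k * m)%N) ?filter_uniq ?divisors_uniq //=.
  by eexists.
rewrite mem_filter -dvdn_divisors ?muln_gt0 ?k0 // dvdnn andbT.
by rewrite -[X in (_ %| X)%N]muln1 dvdn_pmul2l // dvdn1 gtn_eqF.
Qed.

(** The value divides an alternating sum of [n] signs, which is 1 for odd [n]. *)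
Lemma Cyclotomic_N1_odd (n : nat) : odd n -> (1 < n)%N ->
  `|('Phi_n).[-1]|%N = 1%N.
Proof.
move=> odd_n n1; have [q] := Cyclotomic_dvd_sum_Xn 1 n isT n1; rewrite mul1n.
move/(congr1 (fun p => p.[-1])); rewrite hornerM horner_sum => e.
have {}e : 1 = ('Phi_n).[-1] * q.[-1].
  rewrite -e; under eq_bigr do rewrite mul1n hornerXn.
  apply: (@mulfI _ (-1 - 1 : int)) => //.
  by rewrite -subrX1 -signr_odd odd_n expr1 mulr1.
have := congr1 absz e; rewrite abszM => /esym/eqP.
by rewrite muln_eq1 => /andP[/eqP].
Qed.

Lemma sum_Xn_N1_even (k m : nat) : ~~ odd k ->
  (\sum_(i < m) 'X^(k * i) : {poly int}).[-1] = m%:R.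
Proof.
move=> even_k; rewrite horner_sum; under eq_bigr do
  rewrite hornerXn -signr_odd oddM (negbTE even_k) expr0.
by rewrite sumr_const card_ord.
Qed.

(** For odd [n] the value is [+-1]. Otherwise [n = 2 p^l e] with [e] prime to [p], and [e > 1]
    because of the excluded shapes; taking [k = 2 p^l], which is even, makes the value a divisor of
    [e]. *)
Lemma Cyclotomic_N1_ndvd (p n : nat) : prime p -> (2 < n)%N ->
  (forall h, (0 < h)%N -> n <> (2 * p ^ h)%N) -> ~~ (p %| ('Phi_n).[-1])%Z.
Proof.
move=> pp n2 nE; rewrite /dvdz unfold_in /=.
have [odd_n|even_n] := boolP (odd n).
  by rewrite Cyclotomic_N1_odd ?(ltnW n2) // dvdn1 gtn_eqF ?prime_gt1.
have nD : n = (2 * n./2)%N by rewrite mul2n even_halfK.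
have m1 : (1 < n./2)%N by lia.
have [e p_ndvd mE] := pfactor_coprime pp (ltnW m1).
set l := logn p n./2 in mE.
have e1 : (1 < e)%N.
  rewrite ltn_neqAle eq_sym; apply/andP; split; last first.
    by case: e mE {p_ndvd} => // mE; rewrite mE in m1.
  apply/eqP => e1; move: mE; rewrite e1 mul1n => mE.
  case: (posnP l) => [l0|l0]; first by rewrite mE l0 in m1.
  by apply: (nE l l0); rewrite -mE.
have [|q /(congr1 (fun p => p.[-1]))] :=
  Cyclotomic_dvd_sum_Xn (2 * p ^ l) e _ e1.
  by rewrite muln_gt0 expn_gt0 (prime_gt0 pp).
rewrite sum_Xn_N1_even ?oddM // hornerM.
have -> : (2 * p ^ l * e)%N = n by rewrite [RHS]nD mE -mulnA [(e * _)%N]mulnC.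
move/(congr1 absz); rewrite abszM natz /= => eE.
apply: contraL p_ndvd => p_dvd; rewrite prime_coprime // negbK eE.
exact: dvdn_mulr.
Qed.

Lemma Cyclotomic_N1_2pfactor (p h : nat) : prime p -> (0 < h)%N ->
  `|('Phi_(2 * p ^ h)).[-1]|%N = p.
Proof.
move=> pp; case: h => // h _.
have k0 : (0 < 2 * p ^ h)%N by rewrite muln_gt0 expn_gt0 (prime_gt0 pp).
have p1 := prime_gt1 pp; have p0 := ltnW p1.
have nE : (2 * p ^ h.+1 = 2 * p ^ h * p)%N by rewrite expnSr mulnA.
have := prod_Cyclotomic_ndvd (2 * p ^ h) p k0 p0.
move/(congr1 (fun q => absz q.[-1])).
rewrite sum_Xn_N1_even ?oddM // natz /= => pE; rewrite -[RHS]pE -nE.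
rewrite -big_filter.
rewrite (bigD1_seq (2 * p ^ h.+1)%N) ?filter_uniq ?divisors_uniq //=;
  last first.
  rewrite mem_filter -dvdn_divisors ?muln_gt0 ?expn_gt0 ?p0 // dvdnn andbT.
  by rewrite nE -[X in (_ %| X)%N]muln1 dvdn_pmul2l // dvdn1 gtn_eqF.
rewrite hornerM abszM -[LHS]muln1; congr (_ * _)%N; apply: esym.
rewrite big_filter_cond horner_prod big_seq_cond.
elim/big_ind: _ => [//|x y x1 y1|d]; first by rewrite abszM x1 y1.
rewrite -dvdn_divisors ?muln_gt0 ?expn_gt0 ?p0 // => /and3P[d_dvd d_ndvd dD].
(* The values at all [d] multiply to [p], so every factor other than the top one must be [+-1]. An
   even [d = 2e] would have [e] dividing [p^(h+1)] but not [p^h], hence would be the top index. *)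
suff odd_d : odd d.
  rewrite Cyclotomic_N1_odd // ltn_neqAle eq_sym odd_gt0 // andbT.
  by apply: contraNneq d_ndvd => ->; rewrite dvd1n.
rewrite -[odd d]negbK -dvdn2; apply/negP => /dvdnP[e dE].
move: d_dvd d_ndvd dD; rewrite dE mulnC dvdn_pmul2l //.
case/(dvdn_pfactor _ _ pp) => i le_ih ->.
rewrite dvdn_pmul2l // dvdn_Pexp2l // -ltnNge => lt_hi.
by have -> : i = h.+1 by [apply/eqP; rewrite eqn_leq le_ih]; rewrite eqxx.
Qed.

End CyclotomicAtMinusOne.

(** * Congruences and divisibility among algebraic integers *)

Section AlgebraicIntegers.

Local Open Scope ring_scope.

(** Congruences modulo [e] multiply, after a factor [G i] is taken out of each term. The generic
    case uses [G = 1] and [e = p], the exceptional one [G = u j ^+ 2] and [e = u 1]. *)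
Lemma Aint_prod_mod (I : Type) (r : seq I) (P : pred I) (F G C : I -> algC) e :
  e \in Aint -> (forall i, P i -> C i \in Aint) ->
  (forall i, P i -> exists2 v, v \in Aint & F i = G i * (C i + e * v)) ->
  exists2 y, y \in Aint & \prod_(i <- r | P i) F i
    = \prod_(i <- r | P i) G i * (\prod_(i <- r | P i) C i + e * y).
Proof.
move=> Ze ZC dvdF; elim: r => [|i r [y Zy IH]].
  by exists 0; rewrite ?rpred0 // !big_nil mulr0 addr0 mulr1.
rewrite !big_cons; case Pi: (P i); last by exists y.
have [v Zv ->] := dvdF i Pi; rewrite IH.
exists (v * (\prod_(j <- r | P j) C j + e * y) + C i * y); last by ring.
by rewrite rpredD ?rpredM ?rpredD ?rpred_prod ?rpredM ?ZC.
Qed.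

Lemma Aint_prod_dvd (I : Type) (r : seq I) (P : pred I) (F G : I -> algC) :
  (forall i, P i -> exists2 v, v \in Aint & F i = G i * v) ->
  exists2 y, y \in Aint &
    \prod_(i <- r | P i) F i = \prod_(i <- r | P i) G i * y.
Proof.
move=> dvdF.
have [|i Pi|y Zy ->] := @Aint_prod_mod _ r P F G (fun=> 0) 1 Aint1.
- by rewrite rpred0.
- by have [v Zv ->] := dvdF i Pi; exists v; rewrite // add0r mul1r.
by eexists; last reflexivity; rewrite rpredD ?rpredM ?rpred_prod ?rpred0.
Qed.

(** A rational algebraic integer is an integer, so divisibility among algebraic integers descends to
    the integers. *)
Lemma dvdz_Aint (d x : int) (y : algC) : y \in Aint ->
  x%:~R = d%:~R * y -> (d %| x)%Z.
Proof.
move=> Zy xE; have [d0|d_nz] := eqVneq d 0.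
  by move: xE; rewrite d0 mul0r => /eqP; rewrite intr_eq0 => /eqP->.
have d_nzC : d%:~R != 0 :> algC by rewrite intr_eq0.
have yE : y = x%:~R / d%:~R by rewrite xE mulrC mulKf.
have : y \in Num.int.
  by apply: Cint_rat_Aint Zy; rewrite yE rpred_div ?rpred_int.
case/intrP => q yq; apply/dvdzP; exists q.
by apply: (@intr_inj algC); rewrite xE yq mulrC rmorphM.
Qed.

End AlgebraicIntegers.

(** * Atom values as products over roots of unity *)

Section AtomValues.

Local Open Scope ring_scope.

Lemma lucas_atom_value_prod (n : nat) (w : algC) (s t : int) (x y : algC) :
  (1 < n)%N -> n.-primitive_root w -> x + y = s%:~R -> x * y = - t%:~R ->
  (lucas_atom_value s t n)%:~R
    = \prod_(1 <= j < n | coprime j n) (x - w ^+ j * y).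
Proof.
move=> n1 prim_w xDy xMy; pose v := tnth [tuple x; y].
have := congr1 (meval v) (lucas_atomP n1 prim_w); rewrite PhiE //.
rewrite rmorph_prod /=.
under eq_bigr do rewrite mevalB mevalZ !mevalXU /v !(tnth_nth 0) /=.
move=> <-; rewrite /lucas_atom_value; move: (lucas_atom n) => P.
(* Both evaluations are compared monomial by monomial, then variable by variable, where [x + y] and
   [- (x * y)] become [s] and [t]. *)
rewrite (comp_mpolyE P) mevalE.
rewrite [map_mpoly _ _]rmorph_sum [RHS]rmorph_sum rmorph_sum /=.
apply: eq_bigr => m _; rewrite map_mpolyZ mevalZ rmorphM /=; congr (_ * _).
rewrite rmorph_prod [in RHS]rmorph_prod rmorph_prod /=.
apply: eq_bigr => i _; rewrite !rmorphXn /=; congr (_ ^+ _).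
case: (ord2P i) => ->; rewrite !(tnth_nth 0) /=.
  by rewrite rmorphD /= !map_mpolyX mevalD !mevalXU -xDy /v !(tnth_nth 0).
by rewrite rmorphN rmorphM /= !map_mpolyX mevalN mevalM !mevalXU /v
  !(tnth_nth 0) /= xMy opprK.
Qed.

Lemma prod_coprime_const (R : pzRingType) (n : nat) (c : R) : (1 < n)%N ->
  \prod_(1 <= j < n | coprime j n) c = c ^+ totient n.
Proof.
move=> n1; rewrite totient_count_coprime -prodrXr [RHS]big_ltn ?(ltnW n1) //.
rewrite /coprime gcdn0 gtn_eqF // expr0 mul1r big_mkcond; apply: eq_bigr => j _.
by rewrite -/(coprime j n) -/(coprime n j) coprime_sym; case: coprime.
Qed.

Lemma Cyclotomic_N1_prod (n : nat) (w : algC) : (1 < n)%N ->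
  n.-primitive_root w ->
  ('Phi_n).[-1]%:~R
    = (-1) ^+ totient n * \prod_(1 <= j < n | coprime j n) (1 + w ^+ j).
Proof.
move=> n1 prim_w; rewrite -horner_map /= rmorphN1 (Cintr_Cyclotomic prim_w).
rewrite /cyclotomic horner_prod -prod_coprime_const // -big_split /=.
rewrite -(big_mkord (coprime^~ n) (fun k => ('X - (w ^+ k)%:P).[-1])).
rewrite big_mkcond big_ltn ?(ltnW n1) // {1}/coprime gcd0n gtn_eqF //= mul1r.
rewrite -big_mkcond; apply: eq_bigr => j _.
by rewrite hornerXsubC mulN1r opprD.
Qed.

Lemma sum_prod_algC (c d : algC) : exists x y : algC, x + y = c /\ x * y = d.
Proof.
pose e : algC := sqrtC (c ^+ 2 - 4 * d).
have e2 : e ^+ 2 = c ^+ 2 - 4 * d by rewrite sqrtCK.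
exists ((c + e) / 2), ((c - e) / 2); split; first by field.
by transitivity ((c ^+ 2 - e ^+ 2) / 4); [field | rewrite e2; field].
Qed.

Lemma lucas_atom_value2 (s t : int) : lucas_atom_value s t 2 = s.
Proof.
have [w prim_w] := C_prim_root_exists (ltn0Sn 1).
have [x [y [xDy xMy]]] := sum_prod_algC s%:~R (- t%:~R).
have w1 : w = -1.
  have /eqP := prim_expr_order prim_w; rewrite sqrf_eq1 => /orP[]/eqP // w1.
  by have := prim_order_dvd prim_w 1; rewrite w1 expr1n eqxx.
apply: (@intr_inj algC); rewrite (lucas_atom_value_prod 2 w s t x y) //.
by rewrite big_mkcond big_nat1 /= w1 expr1 mulN1r opprK.
Qed.

Lemma sqr_lucas_atom_value (n : nat) (w : algC) (s t : int) : (1 < n)%N ->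
  n.-primitive_root w ->
  (lucas_atom_value s t n)%:~R ^+ 2 = (-1) ^+ totient n *
    \prod_(1 <= j < n | coprime j n)
       (t%:~R * (1 + w ^+ j) ^+ 2 + w ^+ j * s%:~R ^+ 2).
Proof.
move=> n1 prim_w.
have [x [y [xDy xMy]]] := sum_prod_algC s%:~R (- t%:~R).
have yDx : y + x = s%:~R by rewrite addrC.
have yMx : y * x = - t%:~R by rewrite mulrC.
(* One copy of the atom uses the roots as [x, y], the other as [y, x]; the product of matching
   factors is symmetric, so it is expressible in [s] and [t]. *)
rewrite expr2 {1}(lucas_atom_value_prod n w s t x y) //.
rewrite (lucas_atom_value_prod n w s t y x) //.
rewrite -prod_coprime_const // -!big_split /=; apply: eq_bigr => j _.
rewrite -[t%:~R]opprK -xMy -xDy; ring.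
Qed.

End AtomValues.

(** * Valuation of an atom, read off from its square *)

Section Valuations.

Local Open Scope ring_scope.

(** With [s = 0] and [t = 2] the formula for the square reads [P^2 = +-2^phi(n) f^2], where
    [f = Phi_n(-1)] is nonzero because -1 has order 2, less than [n]. Comparing 2-adic valuations
    gives the parity. *)
Lemma even_totient (n : nat) : (2 < n)%N -> ~~ odd (totient n).
Proof.
move=> n2; have n1 := ltnW n2; have [w prim_w] := C_prim_root_exists (ltnW n1).
have fE := Cyclotomic_N1_prod n w n1 prim_w.
set f := ('Phi_n).[-1] in fE.
have f_nz : f != 0.
  apply/negP => /eqP f0; have : root (cyclotomic w n) (-1).
    by rewrite -(Cintr_Cyclotomic prim_w) -(rmorphN1 intr) rootE horner_map /=
      -/f f0.
  rewrite root_cyclotomic // => /prim_order_dvd/(_ 2%N).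
  by rewrite sqrrN expr1n eqxx => /(dvdn_leq (ltn0Sn 1)); rewrite leqNgt n2.
have := sqr_lucas_atom_value n w 0 2 n1 prim_w.
under eq_bigr do rewrite expr0n mulr0 addr0.
rewrite big_split /= prod_coprime_const // prodrXl.
have -> : \prod_(1 <= j < n | coprime j n) (1 + w ^+ j)
    = (-1) ^+ totient n * f%:~R by rewrite fE signrMK.
rewrite exprMn sqrr_sign mul1r; set P := lucas_atom_value _ _ _ => PE.
have {}PE : P ^+ 2 = (-1) ^+ totient n * (2 ^+ totient n * f ^+ 2).
  apply: (@intr_inj algC); rewrite !(rmorphM, rmorphXn) /= -!expr2 PE.
  by rewrite rmorphN1.
have := congr1 (fun x => logn 2 `|x|) PE; rewrite !(abszX, abszM) exp1n mul1n.
rewrite lognM ?expn_gt0 ?absz_gt0 ?f_nz // !lognX.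
rewrite (_ : logn 2 `|2 : int| = 1%N) //; lia.
Qed.

Lemma Euclid_dvdzM (p : nat) (x y : int) : prime p ->
  (p %| x * y)%Z = (p %| x)%Z || (p %| y)%Z.
Proof. by move=> pp; rewrite !dvdzE abszM Euclid_dvdM. Qed.

Lemma Euclid_dvdzX (p k : nat) (x : int) : prime p ->
  (p %| x ^+ k)%Z = (p %| x)%Z && (0 < k)%N.
Proof. by move=> pp; rewrite !dvdzE abszX Euclid_dvdX. Qed.

Lemma vp_sqr (p l : nat) (x z : int) : prime p -> ~~ (p %| z)%Z ->
  x ^+ 2 = p%:Z ^+ (2 * l) * z -> vp p x = Some l.
Proof.
move=> pp p_ndvd xE; have p0 := prime_gt0 pp.
have z0 : (0 < `|z|)%N.
  by rewrite absz_gt0; apply: contraNneq p_ndvd => ->; rewrite dvdz0.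
have xN : (`|x| ^ 2 = p ^ (2 * l) * `|z|)%N.
  by rewrite -abszX xE abszM abszX.
rewrite /vp; case: eqVneq => [x0|x_nz].
  by have := muln_gt0 (p ^ (2 * l)) `|z|; rewrite -xN x0 !expn_gt0 p0 z0.
congr Some; have := congr1 (logn p) xN; rewrite lognX.
rewrite lognM ?expn_gt0 ?p0 // pfactorK //.
have -> : logn p `|z| = 0%N by rewrite logn_coprime // prime_coprime.
lia.
Qed.

(** Here [w^i = (w^j)^k] with [k] odd, and [1 + X] divides [1 + X^k]. Exchanging [i] and [j] shows
    that all these numbers are associates. *)
Lemma dvd_one_add_prim_root (n : nat) (w : algC) (i j : nat) : ~~ odd n ->
  n.-primitive_root w -> coprime i n -> coprime j n ->
  exists2 y, y \in Aint & 1 + w ^+ i = (1 + w ^+ j) * y.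
Proof.
move=> even_n prim_w co_in co_jn.
have Zw := Aint_prim_root prim_w.
have prim_wj : n.-primitive_root (w ^+ j) by rewrite prim_root_exp_coprime.
have [|k wE] := prim_rootP prim_wj (_ : (w ^+ i) ^+ n = 1).
  by rewrite exprAC (prim_expr_order prim_w) expr1n.
have odd_k : odd k.
  have n2 : (2 %| n)%N by rewrite dvdn2.
  have odd_i : odd i.
    by rewrite -[odd i]negbK -dvdn2 -prime_coprime // coprime_sym
      (coprime_dvdr n2).
  move/eqP: wE; rewrite -exprM (eq_prim_root_expr prim_w) => /eqP.
  move/(congr1 (modn^~ 2)); rewrite !modn_dvdm // !modn2 odd_i oddM.
  by case: (odd k); rewrite ?andbF.
exists (\sum_(l < k) (- w ^+ j) ^+ l).
  by rewrite rpred_sum // => l _; rewrite rpredX // rpredN rpredX.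
have := subrX1 (- w ^+ j) k; rewrite exprNn -signr_odd odd_k expr1 mulN1r -wE.
by rewrite -!opprD mulNr => /oppr_inj; rewrite ![_ + 1]addrC.
Qed.

Section Reduction.

Variables (n p b : nat) (w : algC) (s t r t' : int).
Hypotheses (n_gt2 : (2 < n)%N) (prim_w : n.-primitive_root w).
Hypotheses (p_pr : prime p) (p_ndvd : ~~ (p %| t')%Z).
Hypotheses (sE : s ^+ 2 = p%:Z ^+ b.+1 * r) (tE : t = p%:Z ^+ b * t').

Let n_gt1 : (1 < n)%N. Proof. exact: ltnW. Qed.
Let u (j : nat) : algC := 1 + w ^+ j.
Let f := ('Phi_n).[-1].
Let Zw : w \in Aint. Proof. exact: Aint_prim_root prim_w. Qed.
Let Zu j : u j \in Aint. Proof. by rewrite rpredD ?rpredX. Qed.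
Let p_nz : p%:Z != 0. Proof. by rewrite eqz_nat -lt0n prime_gt0. Qed.
Let p_nzC : p%:Z%:~R != 0 :> algC. Proof. by rewrite intr_eq0. Qed.

Let prod_u : \prod_(1 <= j < n | coprime j n) u j = f%:~R.
Proof.
rewrite (Cyclotomic_N1_prod n w) // -signr_odd (negbTE (even_totient n n_gt2)).
by rewrite mul1r.
Qed.

Lemma sqr_lucas_atom_value_reduced :
  exists2 z : int, lucas_atom_value s t n ^+ 2 = p%:Z ^+ (b * totient n) * z &
    z%:~R = \prod_(1 <= j < n | coprime j n)
              (t'%:~R * u j ^+ 2 + p%:~R * (w ^+ j * r%:~R)).
Proof.
set N := \prod_(1 <= j < n | coprime j n) _.
have PE : (lucas_atom_value s t n ^+ 2)%:~R
    = (p%:Z ^+ (b * totient n))%:~R * N :> algC.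
  rewrite rmorphXn /= (sqr_lucas_atom_value n w) //.
  rewrite -signr_odd (negbTE (even_totient n n_gt2)) mul1r.
  rewrite exprM rmorphXn -prod_coprime_const // -big_split /=.
  apply: eq_bigr => j _; rewrite -[s%:~R ^+ 2]rmorphXn /= sE tE
    [p%:Z ^+ b.+1]exprS.
  by rewrite !rmorphM /u /=; ring.
(* [N] is an algebraic integer and a quotient of integers, hence an integer. *)
have ZN : N \in Aint.
  by rewrite rpred_prod // => j _; rewrite rpredD ?rpredM ?rpredX ?Aint_int.
have /dvdzP[z zE] := dvdz_Aint _ _ _ ZN PE.
exists z; first by rewrite zE mulrC.
apply: (@mulfI _ (p%:Z ^+ (b * totient n))%:~R).
  by rewrite intr_eq0 expf_neq0.
by rewrite -PE zE rmorphM mulrC.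
Qed.

Lemma vp_lucas_atom_generic : ~~ (p %| f)%Z ->
  vp p (lucas_atom_value s t n) = Some (b * (totient n)./2)%N.
Proof.
move=> p_ndvd_f; have [z PE zE] := sqr_lucas_atom_value_reduced.
apply: (vp_sqr _ _ _ z) => //; last first.
  by rewrite PE mulnCA mul2n even_halfK ?even_totient.
have [||y Zy] := @Aint_prod_mod _ (index_iota 1 n) (coprime^~ n)
  (fun j => t'%:~R * u j ^+ 2 + p%:~R * (w ^+ j * r%:~R)) (fun=> 1)
  (fun j => t'%:~R * u j ^+ 2) p%:~R (Aint_int p).
- by move=> j _; rewrite rpredM ?rpredX ?Aint_int.
- move=> j _; exists (w ^+ j * r%:~R); last by rewrite mul1r.
  by rewrite rpredM ?rpredX ?Aint_int.
rewrite -zE big_split /= !prod_coprime_const // expr1n mul1r prodrXl prod_u.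
move=> zE'.
have : (p %| z - t' ^+ totient n * f ^+ 2)%Z.
  apply: (dvdz_Aint _ _ _ Zy).
  by rewrite rmorphB rmorphM !rmorphXn /= zE' addrC addKr.
move=> p_dvd; apply: contra p_ndvd_f => p_z.
have : (p %| t' ^+ totient n * f ^+ 2)%Z.
  by rewrite -[X in (_ %| X)%Z](subKr z) rpredB.
rewrite Euclid_dvdzM // !Euclid_dvdzX // (negbTE p_ndvd) /=.
by case/andP.
Qed.

Lemma vp_lucas_atom_exceptional : ~~ odd n -> `|f|%N = p ->
  (3 < totient n)%N || (p %| r)%Z ->
  vp p (lucas_atom_value s t n) = Some (b * (totient n)./2 + 1)%N.
Proof.
move=> even_n fp hr; have [z PE zE] := sqr_lucas_atom_value_reduced.
have phi_gt1 : (1 < totient n)%N by rewrite totient_gt1.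
have co1n : coprime 1 n by exact: coprime1n.
(* Since [f = +-p] is the product of the [u j], all associates of [u 1], the numbers [p] and
   [u 1 ^+ totient n] divide each other; [x1] and [x2] are the two cofactors. *)
have [x1 Zx1 x1E] : exists2 x, x \in Aint & p%:~R = u 1 ^+ totient n * x.
  have [|y Zy] := @Aint_prod_dvd _ (index_iota 1 n) (coprime^~ n) u (fun=> u 1).
    by move=> j co_jn; exact: dvd_one_add_prim_root prim_w _ _.
  rewrite prod_u prod_coprime_const // => fE.
  have : p%:Z = Num.sg f * f by rewrite -fp -normrEsg.
  move/(congr1 (intr : int -> algC)); rewrite rmorphM /= fE => ->.
  by exists ((Num.sg f)%:~R * y); [rewrite rpredM ?Aint_int | ring].
have [x2 Zx2 x2E] : exists2 x, x \in Aint & u 1 ^+ totient n = p%:~R * x.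
  have [|y Zy] := @Aint_prod_dvd _ (index_iota 1 n) (coprime^~ n) (fun=> u 1) u.
    by move=> j co_jn; exact: dvd_one_add_prim_root prim_w _ _.
  rewrite prod_u prod_coprime_const // => ->.
  have : f = Num.sg f * p%:Z by rewrite -fp -numEsg.
  move/(congr1 (intr : int -> algC)); rewrite rmorphM /= => ->.
  by exists ((Num.sg f)%:~R * y); [rewrite rpredM ?Aint_int | ring].
(* Either [p] alone supplies [phi(n) >= 4] factors [u 1], or [p] divides [r] and [p^2] supplies
   [2 phi(n) >= 4] of them. Two are traded below for [u j ^+ 2], and the rest still vanish modulo
   [u 1]. *)
have [y0 Zy0 y0E] : exists2 y, y \in Aint & p%:~R * r%:~R = u 1 ^+ 4 * y.
  case/orP: hr => [phi_gt3|/dvdzP[q ->]].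
    exists (u 1 ^+ (totient n - 4) * x1 * r%:~R).
      by rewrite !rpredM ?rpredX ?Aint_int.
    by rewrite x1E -{1}(subnKC phi_gt3) exprD; ring.
  exists (u 1 ^+ (totient n - 2) ^+ 2 * x1 ^+ 2 * q%:~R).
    by rewrite !rpredM ?rpredX ?Aint_int.
  rewrite rmorphM /= x1E -{1 2}(subnKC phi_gt1) exprD; ring.
have [||y Zy] := @Aint_prod_mod _ (index_iota 1 n) (coprime^~ n)
  (fun j => t'%:~R * u j ^+ 2 + p%:~R * (w ^+ j * r%:~R)) (fun j => u j ^+ 2)
  (fun=> t'%:~R) (u 1) (Zu 1).
- by move=> j _; rewrite Aint_int.
- move=> j co_jn; have [x Zx xE] :=
    dvd_one_add_prim_root _ _ _ _ even_n prim_w co1n co_jn.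
  exists (u 1 * x ^+ 2 * w ^+ j * y0).
    by rewrite !rpredM ?rpredX.
  rewrite [p%:~R * (_ * _)]mulrCA y0E; move: xE; rewrite -/(u 1) -/(u j) => xE.
  have -> : u 1 ^+ 4 = u 1 ^+ 2 * (u j * x) ^+ 2 by rewrite -xE -exprD.
  ring.
rewrite -zE prod_coprime_const // prodrXl prod_u /=.
have f2 : f ^+ 2 = p%:Z ^+ 2 by rewrite -fp abszE real_normK ?num_real.
rewrite -rmorphXn /= f2; set M := (_ + _) => zM.
have ZM : M \in Aint by rewrite rpredD ?rpredM ?rpredX ?Aint_int.
have /dvdzP[m mE] := dvdz_Aint _ _ _ ZM zM.
have ME : m%:~R = M.
  apply: (@mulfI _ (p%:Z ^+ 2)%:~R); first by rewrite intr_eq0 expf_neq0.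
  by rewrite -zM mE mulrC -rmorphM.
apply: (vp_sqr _ _ _ m) => //; last first.
  rewrite PE mE mulnDr muln1 exprD [(2 * _)%N]mulnCA mul2n.
  rewrite even_halfK ?even_totient //.
  ring.
(* If [p] divided [m], then [u 1], a divisor of [p], would divide [t'^phi(n)]; raising to the power
   [phi(n)] turns [u 1] into a multiple of [p], so [p] would divide [t']. *)
apply: contra p_ndvd => /dvdzP[q qE].
pose v := q%:~R * u 1 ^+ (totient n).-1 * x1 - y.
have Zv : v \in Aint by rewrite rpredB ?rpredM ?rpredX ?Aint_int.
have t'E : t'%:~R ^+ totient n = u 1 * v.
  rewrite -[LHS](addrK (u 1 * y)) -/M -ME qE rmorphM /= x1E.
  by rewrite -{1}(prednK (ltnW phi_gt1)) exprS /v; ring.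
have : (p %| t' ^+ (totient n * totient n))%Z.
  apply: (@dvdz_Aint _ _ (x2 * v ^+ totient n)).
    by rewrite rpredM ?rpredX.
  by rewrite rmorphXn /= exprM t'E exprMn x2E mulrA.
by rewrite Euclid_dvdzX // => /andP[].
Qed.

End Reduction.

End Valuations.

(** * Passing from the hypotheses on [a] and [b] to the reduced setting, and the final case split *)

Lemma sqr_ppow_mul (p : nat) (a : natbar) (b : nat) (x : int) : prime p ->
  lt_bar b (omap (fun k => 2 * k) a) ->
  exists2 r : int, (ppow_mul p a x ^+ 2 = p%:Z ^+ b.+1 * r)%R &
    lt_bar b (omap (fun k => 2 * k - 1) a) -> (p %| r)%Z.
Proof.
move=> pp; case: a => [k|] /= b_lt; last first.
  by exists 0%R; rewrite ?mulr0 ?expr0n ?dvdz0.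
exists (p%:Z ^+ (2 * k - b.+1) * x ^+ 2)%R.
  by rewrite mulrA -exprD subnKC // exprMn -exprM mulnC.
(* The exponent [2k - (b + 1)] of [p] in [r] is positive once [b < 2k - 1]. *)
by move=> b_lt'; rewrite Euclid_dvdzM // Euclid_dvdzX // dvdzz; lia.
Qed.

Theorem theorem17 (s t s' t' : int) (p : nat) (a : natbar) (b : nat)
  (p_prime : prime p)
  (sE : s = ppow_mul p a s')
  (tE : t = (p%:Z ^+ b * t')%R)
  (p_ndvd : ~~ (p %| (s' * t')%R)%Z)
  (b_gt0 : 0 < b)
  (a_gt0 : lt_bar 0 a)
  (b_lt_2a : lt_bar b (omap (fun k => 2 * k) a))
  (hyp : (p <> 2 /\ p <> 3) \/ lt_bar b (omap (fun k => 2 * k - 1) a))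
  (n : nat) (n_ge2 : 2 <= n) :
  [/\ n = 2 -> vp p (lucas_atom_value s t n) = a,
      forall h : nat, 1 <= h -> n = 2 * p ^ h ->
        vp p (lucas_atom_value s t n) = Some (b * (totient n)./2 + 1)
    & n <> 2 -> (forall h : nat, 1 <= h -> n <> 2 * p ^ h) ->
        vp p (lucas_atom_value s t n) = Some (b * (totient n)./2)].
Proof.
have [p_ndvd_s p_ndvd_t] : ~~ (p %| s')%Z /\ ~~ (p %| t')%Z.
  by move: p_ndvd; rewrite Euclid_dvdzM // negb_or => /andP[].
have p0 := prime_gt0 p_prime.
split=> [->|h h_gt0 nE|n_neq2 nE].
- rewrite lucas_atom_value2 sE /vp; case: a {sE a_gt0 b_lt_2a hyp} => [k|] //=.
  have s'_nz : s' != 0%R by apply: contraNneq p_ndvd_s => ->; rewrite dvdz0.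
  rewrite mulf_eq0 expf_eq0 (negbTE s'_nz) eqz_nat gtn_eqF // andbF /=.
  congr Some; rewrite abszM abszX absz_nat.
  rewrite lognM ?expn_gt0 ?absz_gt0 ?p0 // pfactorK //.
  by rewrite logn_coprime ?addn0 // prime_coprime.
all: have n_gt2 : 2 < n.
  1: by rewrite nE -[X in X < _]muln1 ltn_pmul2l // -(exp1n h)
    ltn_exp2r ?prime_gt1.
  2: by rewrite ltn_neqAle eq_sym n_ge2 andbT; apply/eqP.
all: have [w prim_w] := C_prim_root_exists (ltnW (ltnW n_gt2)).
all: have [r] := sqr_ppow_mul p a b s' p_prime b_lt_2a.
all: rewrite -sE => sqr_s p_dvd_r.
- apply: (@vp_lucas_atom_exceptional n p b w s t r t') => //.
  + by rewrite nE oddM.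
  + by rewrite nE Cyclotomic_N1_2pfactor.
  (* For [p >= 5], [phi(2 p^h) = p^(h-1) (p - 1)] is at least 4; otherwise [b < 2a - 1] makes [p]
     divide [r]. *)
  case: hyp => [[p_neq2 p_neq3]|/p_dvd_r->]; last by rewrite orbT.
  have p_gt4 : 4 < p.
    by move: p_prime p_neq2 p_neq3; clear; case: p => [|[|[|[|[|]]]]].
  rewrite nE totient_coprime; last first.
    by rewrite coprimeXr // prime_coprime // dvdn_prime2 // eq_sym; apply/eqP.
  rewrite totient_pfactor // mul1n.
  apply/orP; left; have : 0 < p ^ h.-1 by rewrite expn_gt0 p0.
  nia.
apply: (@vp_lucas_atom_generic n p b w s t r t') => //.
exact: Cyclotomic_N1_ndvd.
Qed.
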